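(* Let $(R,\mathfrak m)$ be a Noetherian local ring and $M$ a finite $R$-module of dimension $d>0$. Let $I$ be an $\mathfrak m$-primary ideal of $R$. Then there exists a system of parameters of $M$ which is contained in $I$ and is a $d$-sequence relative to $M$.
   Context: ''Finite'' module means finitely generated. A sequence $x_1,\ldots,x_n$ of elements of $R$ is called a $d$-sequence relative to $M$ if $(x_1,\ldots,x_{i-1})M:_M x_ix_j=(x_1,\ldots,x_{i-1})M:_M x_j$ for all $1\le i\le j\le n$. *)

(* Defs.v *)
From mathcomp Require Import all_boot all_order all_algebra.
From mathcomp Require Import all_classical.

Set Implicit Arguments.
Unset Strict Implicit.
Unset Printing Implicit Defensive.

Import GRing.Theory.
Local Open Scope ring_scope.
Local Open Scope classical_set_scope.

(* Subsets are Prop-valued; [in A] turns A : set T into the boolean predicate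
   that the closure conditions of MathComp expect.  idealr_closed includes
   properness (1 is not in the ideal); ideals that may be the whole ring are
   the submodules of the regular module R^o. *)

Section Modules.
Variable R : comNzRingType.
Implicit Types (V : lmodType R) (I P : set R).

Definition submodule V (N : set V) : Prop := GRing.submod_closed [in N].

Definition ideal I : Prop := @submodule R^o I.

Definition span V (s : seq V) : set V :=
  [set v | exists c : nat -> R, v = \sum_(i < size s) c i *: s`_i].

Definition finite_module V : Prop := exists s : seq V, span s = setT.

Definition gen_ideal (s : seq R) : set R := @span R^o s.

Definition noetherian_ring : Prop :=
  forall I, ideal I -> exists s : seq R, I = gen_ideal s.

Definition prime_ideal P : Prop :=
  idealr_closed [in P] /\ prime_idealr_closed [in P].

Definition maximal_ideal P : Prop :=
  idealr_closed [in P] /\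
  forall J : set R, idealr_closed [in J] -> P `<=` J -> J = P.

Definition local_ring (m : set R) : Prop :=
  maximal_ideal m /\ forall m' : set R, maximal_ideal m' -> m' = m.

Definition radical I : set R := [set a | exists n : nat, I (a ^+ n)].

Definition primary_ideal I : Prop :=
  idealr_closed [in I] /\
  forall a b : R, I (a * b) -> I a \/ exists n : nat, I (b ^+ n).

Definition primary_to (m I : set R) : Prop :=
  primary_ideal I /\ radical I = m.

Definition annihilator V : set R := [set a | forall v : V, a *: v = 0].

Definition prime_chain V (n : nat) (P : nat -> set R) : Prop :=
  (forall i, (i <= n)%N -> prime_ideal (P i) /\ annihilator V `<=` P i) /\
  (forall i, (i < n)%N -> P i `<` P i.+1).

(* dim V = d, where dim V is the Krull dimension of R / Ann V; the primes of
   R / Ann V are the primes of R containing Ann V.  No d qualifies for V = 0. *)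
Definition module_dim V (d : nat) : Prop :=
  (exists P : nat -> set R, prime_chain V d P) /\
  (forall n (P : nat -> set R), prime_chain V n P -> (n <= d)%N).

(* The submodule I V. *)
Definition ideal_smul I V : set V :=
  [set v | exists n (a : 'I_n -> R) (w : 'I_n -> V),
     (forall i, I (a i)) /\ v = \sum_(i < n) a i *: w i].
Arguments ideal_smul : clear implicits.

(* The submodule N :_V a. *)
Definition colon V (N : set V) (a : R) : set V := [set v | N (a *: v)].

(* V / N has finite length: it has a composition series, which is given here
   by its preimage in V, a saturated chain of submodules from N to V. *)
Definition finite_colength V (N : set V) : Prop :=
  exists (n : nat) (C : nat -> set V),
    [/\ C 0%N = N, C n = setT,
        forall i, (i <= n)%N -> submodule (C i) &
        forall i, (i < n)%N -> C i `<` C i.+1 /\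
          forall L : set V, submodule L -> ~ (C i `<` L /\ L `<` C i.+1)].

Definition system_of_parameters (m : set R) V (x : seq R) : Prop :=
  [/\ module_dim V (size x),
      forall a, a \in x -> m a &
      finite_colength (ideal_smul (gen_ideal x) V)].

(* Indices start at 0, so (x_1, ..., x_{i-1}) is generated by take i x. *)
Definition d_sequence V (x : seq R) : Prop :=
  forall i j, (i <= j)%N -> (j < size x)%N ->
    colon (ideal_smul (gen_ideal (take i x)) V) (x`_i * x`_j)
    = colon (ideal_smul (gen_ideal (take i x)) V) x`_j.

End Modules.
Arguments noetherian_ring R : clear implicits.
Arguments ideal_smul {R} I V.

(* Main.v *)
Require Import Defs.
From mathcomp Require Import all_boot all_order all_algebra.
From mathcomp Require Import all_classical.

(** The idea is to choose the elements of the system of parameters generically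
    inside [I], and then to replace each of them by a high power.

    A finite module over a Noetherian ring has a prime filtration: from any
    submodule [N] of [M] one climbs to [M] in finitely many steps, each of the
    form [L + R v] over [L] with [L : v] prime ([exists_prime_filtration]).
    The finite list [ps] of these primes controls [M / N] in two ways.
    - If [w] lies in no member of [ps] other than [m], then multiplication by
      [w] is injective on each factor [R / P] with [P <> m], while [m] kills
      the other factors.  Hence [w v] in [N] forces [z ^+ n v] in [N] as soon
      as [z] is in [m] and [n] is at least the length of the filtration
      ([prime_filtration_kill]).
    - Every prime containing the annihilator of [M / N] contains a member of
      [ps], and every member of [ps] contains that annihilator
      ([prime_filtration_minimal], [prime_filtration_annihilator]).

    Write [N_i] for [(x_1, ..., x_i) M].  No prime other than [m] contains
    [I], so prime avoidance provides [z] in [I] outside all the primes other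
    than [m] attached to [N_0, ..., N_(j-1)], and [x_j] is a large power of [z]
    ([exists_general_sequence]).

    Such a sequence is a d-sequence: if [x_i x_j v] is in [N_(i-1)], apply the
    first fact with [w = x_i x_j]; since [x_j] is a large power, [x_j v] is in
    [N_(i-1)] ([general_sequence_d_sequence]).

    It is also a system of parameters once it has [d] members.  A prime
    [P <> m] containing the annihilator of [M / N_j] contains [x_j] and a
    prime [Q] attached to [N_(j-1)]; as [x_j] avoids [Q], the inclusion
    [Q `<=` P] is strict, and induction yields a chain of length [j] ending
    at [P] ([general_sequence_chain]).  For [j = d] one more step up to [m]
    would contradict [dim M = d].  So all the primes attached to [N_d] are
    [m], and the filtration from [N_d] to [M] is a composition series. *)

Set Implicit Arguments.
Unset Strict Implicit.
Unset Printing Implicit Defensive.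

Import GRing.Theory.
Local Open Scope ring_scope.
Local Open Scope classical_set_scope.

(** * Submodules, spans and conductors *)

Section Submodules.
Variables (R : comNzRingType) (V : lmodType R).
Implicit Types (N : set V) (s : seq V) (u v : V) (a b : R).

Lemma submoduleP N :
  submodule N <-> N 0 /\ forall a u v, N u -> N v -> N (a *: u + v).
Proof.
rewrite /submodule /GRing.submod_closed /GRing.linear_closed.
split=> [[N0 NL]|[N0 NL]]; split; rewrite ?in_setE // in N0 *.
- by move=> a u v Nu Nv; have := NL a u v; rewrite !in_setE; apply.
- by move=> a u v; rewrite !in_setE; apply: NL.
Qed.

Lemma submodule0 N : submodule N -> N 0.
Proof. by case/submoduleP. Qed.

Lemma submoduleZ N a u : submodule N -> N u -> N (a *: u).
Proof. by case/submoduleP=> N0 NL Nu; rewrite -[_ *: _]addr0; apply: NL. Qed.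

Lemma submoduleD N u v : submodule N -> N u -> N v -> N (u + v).
Proof. by case/submoduleP=> _ NL Nu Nv; rewrite -[u]scale1r; apply: NL. Qed.

Lemma submoduleB N u v : submodule N -> N u -> N v -> N (u - v).
Proof.
move=> smN Nu Nv; apply: submoduleD => //.
by rewrite -scaleN1r; apply: submoduleZ.
Qed.

Lemma span_submodule s : submodule (Defs.span s).
Proof.
apply/submoduleP; split.
  by exists (fun=> 0); rewrite big1 // => i _; rewrite scale0r.
move=> a _ _ [c ->] [e ->]; exists (fun i => a * c i + e i).
rewrite scaler_sumr -big_split /=; apply: eq_bigr => i _.
by rewrite scalerDl scalerA.
Qed.

Lemma mem_span s v : v \in s -> Defs.span s v.
Proof.
move=> sv; exists (fun i => (i == index v s)%:R).
have lt_v : (index v s < size s)%N by rewrite index_mem.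
rewrite (bigD1 (Ordinal lt_v)) //= eqxx scale1r nth_index // big1 ?addr0 //.
by move=> i; rewrite -val_eqE /= => /negPf ->; rewrite scale0r.
Qed.

Lemma span_min s N : submodule N -> (forall v, v \in s -> N v) ->
  Defs.span s `<=` N.
Proof.
move=> smN sN _ [c ->]; apply: big_ind => [|u v|i _].
- exact: submodule0.
- exact: submoduleD.
- by apply: submoduleZ => //; apply: sN; apply: mem_nth.
Qed.

(** The submodule [N + R v]. *)
Definition adjoin N v : set V := [set u | exists a, N (u - a *: v)].

(** The annihilator of [v] modulo [N]. *)
Definition conductor N v : set R := [set a | N (a *: v)].

Lemma adjoin_submodule N v : submodule N -> submodule (adjoin N v).
Proof.
move=> smN; apply/submoduleP; split.
  by exists 0; rewrite scale0r subr0; apply: submodule0.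
move=> a u1 u2 [b1 Nu1] [b2 Nu2]; exists (a * b1 + b2).
have -> : a *: u1 + u2 - (a * b1 + b2) *: v
          = a *: (u1 - b1 *: v) + (u2 - b2 *: v).
  by rewrite scalerBr scalerDl scalerA opprD addrACA.
by apply: submoduleD => //; apply: submoduleZ.
Qed.

Lemma sub_adjoin N v : N `<=` adjoin N v.
Proof. by move=> u Nu; exists 0; rewrite scale0r subr0. Qed.

Lemma mem_adjoin N v : submodule N -> adjoin N v v.
Proof. by move=> smN; exists 1; rewrite scale1r subrr; apply: submodule0. Qed.

Lemma adjoin_min N L v :
  submodule L -> N `<=` L -> L v -> adjoin N v `<=` L.
Proof.
move=> smL NL Lv u [a /NL Lu]; rewrite -(subrK (a *: v) u).
by apply: submoduleD => //; apply: submoduleZ.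
Qed.

End Submodules.

Lemma idealP (R : comNzRingType) (J : set R) :
  ideal J <-> J 0 /\ forall a b c, J b -> J c -> J (a * b + c).
Proof. exact: (@submoduleP R R^o). Qed.

Lemma conductor_ideal (R : comNzRingType) (V : lmodType R) (N : set V) v :
  submodule N -> ideal (conductor N v).
Proof.
move=> smN; apply/idealP; split; rewrite /conductor /=.
  by rewrite scale0r; apply: submodule0.
move=> a b c Nb Nc; rewrite scalerDl -scalerA.
by apply: submoduleD => //; apply: submoduleZ.
Qed.

(** * Ideals of Noetherian and local rings *)

Section Ideals.
Variable R : comNzRingType.
Implicit Types (I J P Q m : set R) (a b : R).

Lemma idealr_closedP P : idealr_closed [in P] <-> ideal P /\ ~ P 1.
Proof.
rewrite idealP /idealr_closed; split.
  case; rewrite notin_setE in_setE => P0 P1 PL; split=> //; split=> // a u v.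
  by have := PL a u v; rewrite !in_setE.
case=> -[P0 PL] P1; split; rewrite ?notin_setE ?in_setE // => a u v.
by rewrite !in_setE; apply: PL.
Qed.

Lemma prime_idealP P :
  prime_ideal P <->
  [/\ ideal P, ~ P 1 & forall a b, P (a * b) -> P a \/ P b].
Proof.
rewrite /prime_ideal idealr_closedP /prime_idealr_closed; split.
  case=> -[idP P1] PM; split=> // a b; have := PM a b.
  by rewrite !in_setE => H /H /orP; rewrite !in_setE.
case=> idP P1 PM; split=> // a b.
by rewrite !in_setE => /PM ?; apply/orP; rewrite !in_setE.
Qed.

Lemma ideal0 J : ideal J -> J 0.
Proof. exact: (@submodule0 R R^o). Qed.

Lemma idealD J a b : ideal J -> J a -> J b -> J (a + b).
Proof. exact: (@submoduleD R R^o). Qed.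

Lemma idealB J a b : ideal J -> J a -> J b -> J (a - b).
Proof. exact: (@submoduleB R R^o). Qed.

Lemma gen_ideal_ideal (s : seq R) : ideal (gen_ideal s).
Proof. exact: (@span_submodule R R^o). Qed.

Lemma ideal_mull J a b : ideal J -> J b -> J (a * b).
Proof. exact: (@submoduleZ R R^o). Qed.

Lemma ideal_mulr J a b : ideal J -> J a -> J (a * b).
Proof. by rewrite mulrC; apply: ideal_mull. Qed.

Lemma prime_ideal_exp P a n : prime_ideal P -> P (a ^+ n) -> P a.
Proof.
case/prime_idealP=> idP P1 PM; elim: n => [/P1 //|n IHn].
by rewrite exprS => /PM [].
Qed.

Lemma maximal_ideal_sup m J :
  maximal_ideal m -> ideal J -> ~ J 1 -> m `<=` J -> J = m.
Proof. by case=> _ maxm idJ J1; apply: maxm; apply/idealr_closedP. Qed.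

(** The ideal generated by [m] and [a] is strictly larger than [m], so it
    cannot be proper. *)
Lemma maximal_ideal_inv m a :
  maximal_ideal m -> ~ m a -> exists2 b, m b & exists c, 1 = b + c * a.
Proof.
move=> maxm nma; have [/idealr_closedP [idm m1] _] := maxm.
have idJ : ideal (adjoin (m : set R^o) a) by apply: adjoin_submodule.
have [[c mc]|nJ1] := pselect (adjoin (m : set R^o) a 1).
  by exists (1 - c * a) => //; exists c; rewrite subrK.
case: nma; rewrite -(maximal_ideal_sup maxm idJ nJ1);
  first exact: (@mem_adjoin R R^o).
exact: (@sub_adjoin R R^o).
Qed.

Lemma maximal_ideal_prime m : maximal_ideal m -> prime_ideal m.
Proof.
move=> maxm; have [/idealr_closedP [idm m1] _] := maxm.
apply/prime_idealP; split=> // a b mab.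
have [|nma] := pselect (m a); first by left.
right; have [e me [c defe]] := maximal_ideal_inv maxm nma.
rewrite -[b]mul1r defe mulrDl -mulrA.
by apply: idealD => //; [apply: ideal_mulr | apply: ideal_mull].
Qed.

(** Induction on ideals from larger to smaller ones.  A failure of [Pr] at [J0]
    would propagate along a strictly increasing sequence of ideals; finitely
    many generators of its union already lie in one of its terms. *)
Lemma noetherian_ind (Pr : set R -> Prop) :
  noetherian_ring R ->
  (forall J, ideal J -> (forall K, ideal K -> J `<` K -> Pr K) -> Pr J) ->
  forall J, ideal J -> Pr J.
Proof.
move=> noeth step J0 idJ0; apply: contrapT => nPr0.
pose T := {J : set R | ideal J /\ ~ Pr J}.
have next (J : T) : exists K : T, sval J `<` sval K.
  case: J => J [idJ nPrJ] /=; apply: contrapT => noK.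
  apply: nPrJ; apply: step => // K idK JK; apply: contrapT => nPrK.
  by apply: noK; exists (exist _ K (conj idK nPrK)).
have [f fP] := choice next.
pose J0T : T := exist _ J0 (conj idJ0 nPr0).
pose F n := sval (iter n f J0T).
have idF n : ideal (F n) by case: (svalP (iter n f J0T)).
have Fle n k : (n <= k)%N -> F n `<=` F k.
  move=> le_nk; rewrite -(subnK le_nk); elim: (k - n)%N => // l IHl.
  by apply: (subset_trans IHl); apply: (fP _).1.
pose U := [set a | exists n, F n a].
have idU : ideal U.
  apply/idealP; split; first by exists 0%N; apply: ideal0.
  move=> a u v [i Fu] [j Fv]; exists (maxn i j).
  have Fu' := Fle _ _ (leq_maxl i j) _ Fu.
  have Fv' := Fle _ _ (leq_maxr i j) _ Fv.
  by apply: idealD => //; apply: ideal_mull.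
have [s defU] := noeth _ idU.
have sU a : a \in s -> U a by rewrite defU; apply: (@mem_span R R^o).
have [n Fn] : exists n, forall a, a \in s -> F n a.
  elim: s sU {defU} => [|b s IHs] sU; first by exists 0%N.
  have [|i Fi] := IHs; first by move=> a sa; apply: sU; rewrite inE sa orbT.
  have [j Fj] := sU b (mem_head _ _).
  exists (maxn i j) => a; rewrite inE => /orP [/eqP ->|/Fi].
    exact: (Fle _ _ (leq_maxr i j)).
  exact: (Fle _ _ (leq_maxl i j)).
have [_] := fP (iter n f J0T); apply=> a Fa.
have : U a by exists n.+1.
rewrite defU; apply: (@span_min R R^o s (F n)) => //; exact: idF.
Qed.

(** By Noetherian induction every proper ideal lies in a maximal ideal, and [m]
    is the only one. *)
Lemma prime_sub_local m P :
  noetherian_ring R -> local_ring m -> prime_ideal P -> P `<=` m.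
Proof.
move=> noeth [_ locm] /prime_idealP [idP P1 _]; move: P1.
move: P idP; apply: noetherian_ind => // J idJ IH J1.
have [maxJ|nmaxJ] := pselect (maximal_ideal J); first by rewrite -(locm J maxJ).
apply: contrapT => nJm; apply: nmaxJ; split; first exact/idealr_closedP.
move=> K /idealr_closedP [idK K1] JK; apply: contrapT => nKJ.
apply: nJm; apply: (subset_trans JK); apply: IH => //.
by split=> // KJ; apply: nKJ; apply/seteqP.
Qed.

(** Induction on the list.  Let [z] avoid the tail [ps] but lie in the head [P].
    Add to [z] a multiple [t * b] outside [P], with [t] in [I] and with [b] in
    each member of [ps] that is not contained in [P].  The sum avoids [P], hence
    also the members of [ps] contained in [P]; and it is congruent to [z] modulo
    the other ones.  Inclusions between the primes are thus allowed. *)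
Lemma prime_avoidance I (ps : seq (set R)) :
  ideal I -> (forall Q, Q \in ps -> prime_ideal Q /\ ~ I `<=` Q) ->
  exists2 z, I z & forall Q, Q \in ps -> ~ Q z.
Proof.
move=> idI; elim: ps => [|P ps IHps] psP.
  by exists 0 => //; apply: ideal0.
have [|z Iz nz] := IHps.
  by move=> Q psQ; apply: psP; rewrite inE psQ orbT.
have [/prime_idealP [idP P1 PM] nIP] := psP P (mem_head _ _).
have [Pz|nPz] := pselect (P z); last first.
  by exists z => // Q; rewrite inE => /orP [/eqP ->|/nz].
have [t [It nPt]] := nonsubset nIP.
have [b nPb bP] : exists2 b, ~ P b & forall Q, Q \in ps -> Q `<=` P \/ Q b.
  have {}psP Q : Q \in ps -> prime_ideal Q.
    by move=> psQ; case: (psP Q); rewrite ?inE ?psQ ?orbT.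
  elim: ps psP {IHps nz} => [|Q qs IHqs] qsP; first by exists 1.
  have [|b nPb bP] := IHqs.
    by move=> K qsK; apply: qsP; rewrite inE qsK orbT.
  have idK K : K \in Q :: qs -> ideal K by case/qsP/prime_idealP.
  have [QP|/nonsubset [c [Qc nPc]]] := pselect (Q `<=` P).
    by exists b => // K; rewrite inE => /orP [/eqP ->|/bP //]; left.
  exists (c * b) => [/PM []//|K qsK].
  move: (qsK) (idK K qsK); rewrite inE => /orP [/eqP -> idQ|/bP [|Kb] idK'].
  - by right; apply: ideal_mulr.
  - by left.
  - by right; apply: ideal_mull.
have nPy : ~ P (z + t * b).
  move=> /(idealB (b := z) idP) /(_ Pz); rewrite addrC addrA addNr add0r.
  by case/PM.
exists (z + t * b).
  by apply: idealD => //; apply: ideal_mulr.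
move=> Q; rewrite inE => /orP [/eqP -> //|psQ Qy].
have [/(_ _ Qy) //|Qb] := bP Q psQ.
have [/prime_idealP [idQ _ _] _] : prime_ideal Q /\ ~ I `<=` Q.
  by apply: psP; rewrite inE psQ orbT.
apply: (nz Q psQ); rewrite -(addrK (t * b) z).
by apply: idealB => //; apply: ideal_mull.
Qed.

End Ideals.

(** * Prime filtrations *)

Section Filtrations.
Variables (R : comNzRingType) (V : lmodType R).
Implicit Types (N L : set V) (u v : V) (P Q : set R) (ps : seq (set R)).

(** The list records the primes [P] for which [R / P] is a successive quotient
    of the filtration, which always ends at the whole module. *)
Inductive prime_filtration : set V -> seq (set R) -> Prop :=
| PrimeFiltrationTop : prime_filtration setT [::]
| PrimeFiltrationStep N v ps :
    prime_ideal (conductor N v) -> prime_filtration (adjoin N v) ps ->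
    prime_filtration N (conductor N v :: ps).

(** A nonzero cyclic submodule of [V / N] has an associated prime.
    If [N : v] is not prime, it contains a product [a * b] but neither [a] nor
    [b]; then [N : a v] contains [b], so it is strictly larger than [N : v]. *)
Lemma exists_prime_conductor N v :
  noetherian_ring R -> submodule N -> ~ N v ->
  exists a, prime_ideal (conductor N (a *: v)).
Proof.
move=> noeth smN nNv.
have [J defJ] : exists J, J = conductor N v by exists (conductor N v).
have idJ : ideal J by rewrite defJ; apply: conductor_ideal.
move: J idJ v nNv defJ; apply: noetherian_ind => // J idJ IH v nNv defJ.
have [primeJ|nprimeJ] := pselect (prime_ideal (conductor N v)).
  by exists 1; rewrite scale1r.
have [a [b [Nab [nNa nNb]]]] :
    exists a b, N ((a * b) *: v) /\ ~ N (a *: v) /\ ~ N (b *: v).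
  apply: contrapT => noab; apply: nprimeJ; apply/prime_idealP; split.
  - exact: conductor_ideal.
  - by rewrite /conductor /= scale1r.
  move=> a b Jab; apply: contrapT => /not_orP [nNa nNb].
  by apply: noab; exists a, b.
have [||||c] := IH (conductor N (a *: v)) _ _ (a *: v) => //.
- exact: conductor_ideal.
- rewrite defJ; split=> [e Ne|/(_ b)].
    by rewrite /conductor /= scalerA mulrC -scalerA; apply: submoduleZ.
  by apply: contra_not nNb; apply; rewrite /conductor /= scalerA mulrC.
- by rewrite scalerA; exists (c * a).
Qed.

(** Insertion of a cyclic module below a filtration, by Noetherian induction on
    [N : v].  Pick [a] with [N : a v] prime and first adjoin [a v]; this makes
    the conductor of [v] strictly larger, because it now contains [a]. *)
Lemma prime_filtration_adjoin N v :
  noetherian_ring R -> submodule N ->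
  (exists ps, prime_filtration (adjoin N v) ps) ->
  exists ps, prime_filtration N ps.
Proof.
move=> noeth smN.
have [J defJ] : exists J, J = conductor N v by exists (conductor N v).
have idJ : ideal J by rewrite defJ; apply: conductor_ideal.
move: J idJ N smN defJ; apply: noetherian_ind => // J idJ IH N smN defJ filN.
have [Nv|nNv] := pselect (N v).
  suff <- : adjoin N v = N by [].
  by apply/seteqP; split; [apply: adjoin_min | apply: sub_adjoin].
have [a primea] := exists_prime_conductor noeth smN nNv.
have smNa := adjoin_submodule (a *: v) smN.
have [|||||ps filNa] :=
  IH (conductor (adjoin N (a *: v)) v) _ _ (adjoin N (a *: v)).
- exact: conductor_ideal.
- rewrite defJ; split=> [e Ne|/(_ a)]; first exact: sub_adjoin.
  case/prime_idealP: primea => _; rewrite /conductor /= scale1r => nNa _.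
  by apply: contra_not nNa; apply; apply: mem_adjoin.
- exact: smNa.
- by [].
- have -> // : adjoin (adjoin N (a *: v)) v = adjoin N v.
  have smNv := adjoin_submodule v smN.
  have Nvv := mem_adjoin v smN.
  apply/seteqP; split.
    apply: adjoin_min => //; apply: adjoin_min => //; first exact: sub_adjoin.
    exact: submoduleZ.
  apply: adjoin_min; [exact: adjoin_submodule| |exact: mem_adjoin].
  by apply: subset_trans (@sub_adjoin _ _ _ _) (@sub_adjoin _ _ _ _).
- by exists (conductor N (a *: v) :: ps); apply: PrimeFiltrationStep.
Qed.

Lemma exists_prime_filtration N :
  noetherian_ring R -> finite_module V -> submodule N ->
  exists ps, prime_filtration N ps.
Proof.
move=> noeth [s defV] smN.
have : forall L, submodule L -> N `<=` L -> (forall v, v \in s -> L v) ->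
    L = setT.
  move=> L smL _ sL; apply/seteqP; split=> // v _.
  by apply: (span_min smL sL); rewrite defV.
elim: s N smN {defV} => [|v s IHs] N smN genN.
  by rewrite (genN N) //; exists [::]; apply: PrimeFiltrationTop.
apply: (@prime_filtration_adjoin _ v) => //; apply: IHs.
  exact: adjoin_submodule.
move=> L smL NvL sL; apply: genN => //.
  by apply: subset_trans NvL; apply: sub_adjoin.
move=> u; rewrite inE => /orP [/eqP ->|/sL //].
by apply: NvL; apply: mem_adjoin.
Qed.

Lemma prime_filtration_prime N ps Q :
  prime_filtration N ps -> Q \in ps -> prime_ideal Q.
Proof.
elim=> // {}N v {}ps primev _ IH.
by rewrite inE => /orP [/eqP ->|/IH].
Qed.

Lemma prime_filtration_annihilator N ps Q a :
  submodule N -> prime_filtration N ps -> Q \in ps ->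
  (forall v, N (a *: v)) -> Q a.
Proof.
move=> + fil; elim: fil => // {}N v {}ps _ _ IH smN.
rewrite inE => /orP [/eqP -> aV|psQ aV]; first exact: aV.
by apply: IH => // [|u]; [apply: adjoin_submodule | apply: sub_adjoin].
Qed.

(** If no conductor of the filtration is contained in [P], the product of one
    element outside [P] from each of them is outside [P] and maps the whole
    module into [N]. *)
Lemma prime_filtration_minimal N ps P :
  submodule N -> prime_filtration N ps -> prime_ideal P ->
  [set a | forall v, N (a *: v)] `<=` P ->
  exists2 Q, Q \in ps & Q `<=` P.
Proof.
move=> smN fil /prime_idealP [idP P1 PM] annP; apply: contrapT => noQ.
suff [a nPa aV] : exists2 a, ~ P a & forall v, N (a *: v) by exact/nPa/annP.
have {noQ annP} : forall Q, Q \in ps -> ~ Q `<=` P.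
  by move=> Q psQ QP; apply: noQ; exists Q.
elim: fil smN => [_ _|{}N v {}ps _ _ IH smN nQP]; first by exists 1.
have [|Q psQ|a nPa aV] := IH; first exact: adjoin_submodule.
  by apply: nQP; rewrite inE psQ orbT.
have /nonsubset [b [Nbv nPb]] := nQP _ (mem_head _ _).
exists (b * a) => [/PM []//|u]; have [c Nu] := aV u.
rewrite -scalerA -(subrK (c *: v) (a *: u)) scalerDr.
apply: submoduleD => //; first exact: submoduleZ.
by rewrite scalerA mulrC -scalerA; apply: submoduleZ.
Qed.

(** Going down the filtration, one multiplication by [z] suffices at each step.
    Let [w] multiply [c u] into [N], so that [w * c] is in the prime [N : u].
    If this prime is not [m], it contains [c] because it does not contain [w];
    if it is [m], it contains [z].  In both cases it contains [z * c]. *)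
Lemma prime_filtration_kill m N ps w z v n :
  submodule N -> prime_filtration N ps -> m z ->
  (forall Q, Q \in ps -> Q != m -> ~ Q w) -> (size ps <= n)%N ->
  N (w *: v) -> N (z ^+ n *: v).
Proof.
move=> smN fil mz wps le_n Nwv.
suff Nz : N (z ^+ size ps *: v).
  by rewrite -(subnK le_n) exprD -scalerA; apply: submoduleZ.
elim: fil v smN wps Nwv {le_n} => [//|{}N u {}ps primeu _ IH] v smN wps Nwv.
have zv : adjoin N u (z ^+ size ps *: v).
  apply: IH; first exact: adjoin_submodule.
    by move=> Q psQ; apply: wps; rewrite inE psQ orbT.
  exact: sub_adjoin.
case: zv => c Nc; rewrite /= exprS -scalerA.
set y := z ^+ size ps *: v in Nc *.
have Nwc : conductor N u (w * c).
  have Nwy : N (w *: y).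
    by rewrite /y scalerA mulrC -scalerA; apply: submoduleZ.
  rewrite /conductor /= -scalerA.
  have -> : w *: (c *: u) = w *: y - w *: (y - c *: u).
    by rewrite scalerBr opprB addrC subrK.
  by apply: submoduleB => //; apply: submoduleZ.
have Nzc : conductor N u (z * c).
  case/prime_idealP: (primeu) => idu _ uM.
  have [defm|neqm] := eqVneq (conductor N u) m.
    by apply: ideal_mulr => //; rewrite defm.
  case: (uM _ _ Nwc) => [/(wps _ (mem_head _ _) neqm) //|].
  exact: ideal_mull.
rewrite -(subrK (c *: u) y) scalerDr.
apply: submoduleD => //; first exact: submoduleZ.
by rewrite scalerA.
Qed.

(** The filtration itself is a composition series.  If [L] is strictly larger
    than [N] inside [N + R v], it contains some [a v] with [a] outside [m].
    As [m v] is in [N] and [m] and [a] together generate [R], [v] is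
    in [L]. *)
Lemma prime_filtration_finite_colength m N ps :
  maximal_ideal m -> submodule N -> prime_filtration N ps ->
  (forall Q, Q \in ps -> Q = m) -> finite_colength N.
Proof.
move=> maxm + fil; elim: fil => [|{}N v {}ps primev _ IH] smN psm.
  by exists 0%N, (fun=> setT); split.
have smNv := adjoin_submodule v smN.
have [|n [C [C0 Cn Csm Cmax]]] := IH smNv.
  by move=> Q psQ; apply: psm; rewrite inE psQ orbT.
have defm := psm _ (mem_head _ _).
exists n.+1, (fun i => if i is j.+1 then C j else N); split=> //.
  by case=> // i /Csm.
case=> [_|i /Cmax //]; rewrite C0; split.
  split; first exact: sub_adjoin.
  move=> /(_ v (mem_adjoin v smN)) Nv.
  by case/prime_idealP: primev => _; rewrite /conductor /= scale1r.
move=> L smL [[NL /nonsubset [u [Lu nNu]]] [LNv nNvL]].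
apply: nNvL; apply: adjoin_min => //; have [a Na] := LNv _ Lu.
have nma : ~ m a.
  rewrite -defm => Nav; apply: nNu; rewrite -(subrK (a *: v) u).
  exact: submoduleD.
have [b mb [c def1]] := maximal_ideal_inv maxm nma.
rewrite -[v]scale1r def1 scalerDl; apply: submoduleD => //.
  by apply: NL; move: mb; rewrite -defm.
rewrite -scalerA; apply: submoduleZ => //.
have -> : a *: v = u - (u - a *: v) by rewrite opprB addrC subrK.
by apply: submoduleB => //; apply: NL.
Qed.

End Filtrations.

Lemma prime_chain_extend (R : comNzRingType) (V : lmodType R) n C (P : set R) :
  prime_chain V n C -> prime_ideal P -> C n `<` P ->
  exists2 C', prime_chain V n.+1 C' & C' n.+1 = P.
Proof.
move=> [Cprime Clt] primeP CP.
exists (fun i => if (i <= n)%N then C i else P); last by rewrite ltnn.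
split=> i le_i.
  case: ifP => [/Cprime //|_]; split=> //.
  by have [_ annC] := Cprime n (leqnn n); apply: subset_trans CP.1.
rewrite ltnS in le_i; rewrite le_i; case: ltnP => [/Clt //|le_ni].
by have -> : i = n by apply/eqP; rewrite eqn_leq le_i.
Qed.

(** * Submodules generated by multiples *)

Section IdealSmul.
Variables (R : comNzRingType) (V : lmodType R).
Implicit Types (J K : set R) (x : seq R).

Lemma ideal_smul_submodule J : ideal J -> submodule (ideal_smul J V).
Proof.
move=> idJ; apply/submoduleP; split.
  by exists 0%N, (fun=> 0), (fun=> 0); split; [case | rewrite big_ord0].
move=> a _ _ [n1 [a1 [w1 [Ja1 ->]]]] [n2 [a2 [w2 [Ja2 ->]]]].
exists (n1 + n2)%N,
  (fun i => match fintype.split i with inl j => a * a1 j | inr j => a2 j end),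
  (fun i => match fintype.split i with inl j => w1 j | inr j => w2 j end).
split=> [i|]; first by case: (fintype.split i) => j //; apply: ideal_mull.
rewrite big_split_ord scaler_sumr; congr (_ + _); apply: eq_bigr => i _.
  by rewrite -/(unsplit (inl i)) unsplitK scalerA.
by rewrite -/(unsplit (inr i)) unsplitK.
Qed.

Lemma ideal_smulS J K : J `<=` K -> ideal_smul J V `<=` ideal_smul K V.
Proof.
by move=> JK _ [n [a [w [Ja ->]]]]; exists n, a, w; split=> // i; apply: JK.
Qed.

Lemma mem_ideal_smul J a (v : V) : J a -> ideal_smul J V (a *: v).
Proof.
move=> Ja; exists 1%N, (fun=> a), (fun=> v); split=> //.
by rewrite big_ord_recl big_ord0 addr0.
Qed.

Lemma ideal_smul_nil : ideal_smul (gen_ideal [::]) V = [set 0 : V].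
Proof.
apply/seteqP; split=> [_ [n [a [w [Ja ->]]]]|_ ->].
  rewrite big1 //= => i _; have [c ->] := Ja i.
  by rewrite big_ord0 scale0r.
by apply: submodule0; apply: ideal_smul_submodule; apply: gen_ideal_ideal.
Qed.

Lemma sub_gen_ideal_take x i j :
  (i <= j)%N -> gen_ideal (take i x) `<=` gen_ideal (take j x).
Proof.
move=> le_ij; apply: (@span_min R R^o); first exact: gen_ideal_ideal.
move=> a; rewrite -(take_takel x le_ij) => /mem_take; exact: (@mem_span R R^o).
Qed.

End IdealSmul.

(** * Sequences of general elements *)

Section GeneralSequences.
Variables (R : comNzRingType) (M : lmodType R) (m I : set R).
Variable F : set M -> seq (set R).
Hypotheses (noethR : noetherian_ring R) (localR : local_ring m).
Hypothesis FP : forall N, submodule N -> prime_filtration N (F N).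
Implicit Types (x : seq R).

Definition partial_smul x i := ideal_smul (gen_ideal (take i x)) M.

Let partial_smul_submodule x i : submodule (partial_smul x i).
Proof. by apply: ideal_smul_submodule; apply: gen_ideal_ideal. Qed.

(** [F N] is a chosen list of primes of a filtration from [N] to [M].  The
    second condition says that [z] kills everything that can be killed modulo
    [N] by an element avoiding the primes of [F N] other than [m], that is, the
    part of [M / N] supported at [m]. *)
Definition general_element N z : Prop :=
  (forall Q, Q \in F N -> Q != m -> ~ Q z) /\
  (forall w v, (forall Q, Q \in F N -> Q != m -> ~ Q w) ->
     N (w *: v) -> N (z *: v)).

Definition general_sequence x : Prop :=
  forall i j, (i <= j < size x)%N -> general_element (partial_smul x i) x`_j.

(** Prime avoidance gives [z] outside the relevant primes, none of which
    contains [I] since [m] is the radical of [I].  A power of [z] beyond the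
    lengths of all the filtrations has both required properties. *)
Lemma exists_general_element (k : nat) (N : nat -> set M) :
  primary_to m I -> (forall i, submodule (N i)) ->
  exists2 z, I z & forall i, (i <= k)%N -> general_element (N i) z.
Proof.
move=> [[/idealr_closedP [idI I1] _] radI] smN.
have [maxm _] := localR.
have primeF i Q : Q \in F (N i) -> prime_ideal Q.
  exact: prime_filtration_prime (FP (smN i)).
pose ps := [seq Q <- flatten [seq F (N i) | i <- iota 0 k.+1] | Q != m].
have psP i Q : (i <= k)%N -> Q \in F (N i) -> Q != m -> Q \in ps.
  move=> le_ik FQ neqm; rewrite mem_filter neqm; apply/flatten_mapP.
  by exists i => //; rewrite mem_iota.
have [Q|z Iz nz] := @prime_avoidance _ I ps idI.
  rewrite mem_filter => /andP [/eqP neqm /flatten_mapP [i _ /primeF primeQ]].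
  split=> // IQ; apply: neqm; case/prime_idealP: (primeQ) => idQ Q1 _.
  apply: maximal_ideal_sup => // a; rewrite -radI => -[n /IQ].
  exact: prime_ideal_exp.
pose n := \max_(i < k.+1) size (F (N i)).
have mz : m z by rewrite -radI; exists 1%N.
exists (z ^+ n.+1); first by rewrite exprS; apply: ideal_mulr.
move=> i le_ik; split=> [Q FQ neqm|w v nw Nwv].
  by move/(prime_ideal_exp (primeF _ _ FQ)); apply: nz; apply: psP FQ neqm.
apply: (@prime_filtration_kill _ _ m _ (F (N i)) w) => //; first exact: FP.
apply: leqW; have lt_ik : (i < k.+1)%N by [].
exact: (@leq_bigmax _ (fun j : 'I_k.+1 => size (F (N j))) (Ordinal lt_ik)).
Qed.

Lemma exists_general_sequence n :
  primary_to m I ->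
  exists x, [/\ size x = n, forall a, a \in x -> I a & general_sequence x].
Proof.
move=> primI; elim: n => [|n [x [sx xI gx]]].
  by exists [::]; split=> // i j; rewrite andbF.
have [z Iz gz] :=
  exists_general_element n primI (partial_smul_submodule x).
exists (rcons x z); split; first by rewrite size_rcons sx.
  by move=> a; rewrite mem_rcons inE => /orP [/eqP ->|/xI].
move=> i j; rewrite size_rcons ltnS => /andP [le_ij le_jx].
rewrite /partial_smul -cats1 takel_cat ?(leq_trans le_ij) // cats1.
rewrite -/(partial_smul x i).
rewrite nth_rcons; case: ltngtP le_jx => // [lt_jx _|ejx _].
  by apply: gx; rewrite le_ij.
by apply: gz; rewrite -sx -ejx.
Qed.

(** The product [x_i x_j] avoids the same primes as its factors, so [x_j] kills
    modulo [(x_1, ..., x_(i-1)) M] whatever [x_i x_j] does. *)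
Lemma general_sequence_d_sequence x : general_sequence x -> d_sequence M x.
Proof.
move=> gx i j le_ij lt_jx; rewrite -/(partial_smul x i).
have [|nxi _] := gx i i; first by rewrite leqnn (leq_ltn_trans le_ij).
have [|nxj killj] := gx i j; first by rewrite le_ij.
apply/seteqP; split=> v; last first.
  by rewrite /colon /= -scalerA; apply: submoduleZ.
apply: killj => Q FQ neqm.
have /prime_idealP [_ _ QM] :=
  prime_filtration_prime (FP (partial_smul_submodule x i)) FQ.
by case/QM; [apply: nxi | apply: nxj].
Qed.

(** In other words, [P] has height at least [j] in the support of [M]: each of
    [x_1, ..., x_j] lies in [P] but outside some smaller prime of the support of
    the quotient by the elements before it. *)
Lemma general_sequence_chain x j P :
  general_sequence x -> (j <= size x)%N -> prime_ideal P -> P <> m ->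
  [set a | forall v, partial_smul x j (a *: v)] `<=` P ->
  exists2 C, prime_chain M j C & C j = P.
Proof.
move=> gx; elim: j P => [|j IHj] P le_j primeP neqm annP.
  exists (fun=> P) => //; split=> // i _; split=> // a aM; apply: annP => v.
  by rewrite /partial_smul take0 ideal_smul_nil; apply: aM.
have smNj := partial_smul_submodule x j.
have [|Q FQ QP] := prime_filtration_minimal smNj (FP smNj) primeP.
  apply: subset_trans annP => a aN v.
  by apply: ideal_smulS (aN v); apply: sub_gen_ideal_take.
have primeQ := prime_filtration_prime (FP smNj) FQ.
have neqQm : Q <> m.
  move=> eQm; apply: neqm; case: localR => maxm _.
  case/prime_idealP: primeP => idP P1 _.
  by apply: (maximal_ideal_sup maxm idP P1); rewrite -eQm.
have [||||C chainC Cj] := IHj Q => //; first exact: ltnW.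
  by move=> a; apply: prime_filtration_annihilator (FP smNj) FQ.
have Pxj : P x`_j.
  apply: annP => v; apply/mem_ideal_smul/(@mem_span R R^o).
  by rewrite (take_nth 0) // mem_rcons mem_head.
have [|nxj _] := gx j j; first by rewrite leqnn.
apply: (prime_chain_extend chainC primeP).
by rewrite Cj; split=> // /(_ _ Pxj); apply: nxj => //; apply/eqP.
Qed.

(** If a prime other than [m] were attached to the last quotient, the chain
    ending at it would extend to [m] and have length [dim M + 1]. *)
Lemma general_sequence_finite_colength x :
  module_dim M (size x) -> general_sequence x ->
  finite_colength (ideal_smul (gen_ideal x) M).
Proof.
move=> [_ dimM] gx; have [maxm _] := localR.
have smN := partial_smul_submodule x (size x).
rewrite -{1}[x]take_size -/(partial_smul x (size x)).
apply: (prime_filtration_finite_colength maxm smN (FP smN)) => Q FQ.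
apply: contrapT => neqm; have primeQ := prime_filtration_prime (FP smN) FQ.
have [||||C chainC CQ] := @general_sequence_chain x (size x) Q gx => //.
  by move=> a; apply: prime_filtration_annihilator (FP smN) FQ.
have Qm := prime_sub_local noethR localR primeQ.
have [||C' /dimM] := prime_chain_extend chainC (_ : prime_ideal m).
- exact: maximal_ideal_prime.
- by rewrite CQ; split=> // mQ; apply: neqm; apply/seteqP.
- by rewrite ltnn.
Qed.

End GeneralSequences.

(** * Existence of the system of parameters *)

Theorem proposition2p5 (R : comNzRingType) (m : set R) (M : lmodType R)
    (d : nat) (I : set R) :
  noetherian_ring R -> local_ring m ->
  finite_module M -> module_dim M d -> (0 < d)%N ->
  primary_to m I ->
  exists x : seq R,
    [/\ system_of_parameters m M x,
        forall a, a \in x -> I a &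
        d_sequence M x].
Proof.
move=> noethR localR finM dimM _ primI.
have /choice [F FP] : forall N : set M, exists ps,
    submodule N -> prime_filtration N ps.
  move=> N; have [smN|nsmN] := pselect (submodule N); last by exists [::].
  by have [ps] := exists_prime_filtration noethR finM smN; exists ps.
have [x [sx xI gx]] := exists_general_sequence localR FP d primI.
exists x; split=> //; last exact (general_sequence_d_sequence FP gx).
rewrite -sx in dimM; split=> //.
  by move=> a /xI Ia; case: primI => _ <-; exists 1%N.
exact (general_sequence_finite_colength noethR localR FP dimM gx).
Qed.
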